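(* Let $n\ge 6$ and $q\ge 4$ be integers, and let $t=\lceil \log_2 n\rceil$. Then for every integer $a$ with $0\le a\le n-1$ and every $b\in\mathbb{Z}_q$, $$|\mathcal{VT}_{a,b}(n)|\ \ge\ (q-1)^{2t-5}\,q^{\,n-3t+3}\ =\ q^{\,n\left(1-\frac{t}{n}\left[3\log_q q-2\log_q(q-1)\right]-\frac1n\left[5\log_q(q-1)-3\log_q q\right]\right)} .$$
   Context: $\mathbb{Z}_q=\{0,1,\dots,q-1\}$ is the ring of integers modulo $q$, with its elements ordered naturally $0<1<\dots<q-1$. For a sequence $S=s_0s_1\cdots s_{n-1}\in\mathbb{Z}_q^n$, the auxiliary binary sequence $A_S=\alpha_1\alpha_2\cdots\alpha_{n-1}$ of length $n-1$ is defined by $\alpha_i=1$ if $s_i\ge s_{i-1}$ and $\alpha_i=0$ if $s_i<s_{i-1}$, for $1\le i\le n-1$. Its VT syndrome is $\mathsf{syn}(A_S)=\sum_{i=1}^{n-1} i\,\alpha_i \bmod n$, an element of $\{0,\dots,n-1\}$. (In general, the VT syndrome of a binary sequence of length $N$ is taken modulo $N+1$.) The modular sum is $\mathsf{sum}(S)=\sum_{i=0}^{n-1}s_i \bmod q$. For $0\le a\le n-1$ and $b\in\mathbb{Z}_q$, the $q$-ary Varshamov–Tenengolts code of length $n$ with parameters $(a,b)$ is $$\mathcal{VT}_{a,b}(n)=\{S\in\mathbb{Z}_q^n:\ \mathsf{syn}(A_S)=a,\ \mathsf{sum}(S)=b\}.$$ *)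

(* Defs.v *)
From HB Require Import structures.
From mathcomp Require Import all_boot all_order all_algebra.
From mathcomp Require Import reals exp.
Set Implicit Arguments.
Unset Strict Implicit.
Unset Printing Implicit Defensive.
Import GRing.Theory.
Local Open Scope ring_scope.

(* VT syndrome of a binary sequence A = alpha_1 ... alpha_N, taken modulo N+1;
   alpha_i is the entry of A at position i.-1. *)
Definition vt_syn (A : seq bool) : nat :=
  ((\sum_(1 <= i < (size A).+1) i * nth false A i.-1) %% (size A).+1)%N.

(* 'Z_q is the ring of integers modulo q only when 1 < q. The comparison is that
   of the representatives in {0, ..., q-1}. For S = s_0 ... s_{n-1}, the entry at
   position i is alpha_{i+1}, so it compares s_{i+1} with s_i. *)
Definition aux_seq (q : nat) (S : seq 'Z_q) : seq bool :=
  mkseq (fun i => (nth 0%R S i <= nth 0%R S i.+1)%N) (size S).-1.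

Definition VT (q n a : nat) (b : 'Z_q) : {set n.-tuple 'Z_q} :=
  [set S : n.-tuple 'Z_q |
    (vt_syn (aux_seq S) == a) && (\sum_(i < n) tnth S i == b)].

Definition logb (R : realType) (b x : R) : R := ln x / ln b.

(* Main.v *)
(* Keep most symbols free and use the others to reach syndrome [a] and sum [b].
   For each power of two i with 4 <= i < n, put x = s_(i-1) <> 0 and let s_i be
   x or x - 1: this sets alpha_i to 1 or 0, and alpha_(i+1) does not depend on
   the choice as soon as s_(i+1) <> x - 1. Fixing s_3 = q - 1 forces alpha_3 = 1
   whatever s_2 is, and since q >= 4 the symbols s_0, s_1, s_2 can realise any
   alpha_1, alpha_2 together with any sum. So all the alpha_(2^j) can be set
   independently of the free symbols, and their weights 2^j < n reach every
   residue modulo n by binary expansion. Counting the free symbols, with q - 1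
   choices next to a power of two and q elsewhere, gives the bound. *)
Require Import Defs.
From HB Require Import structures.
From mathcomp Require Import all_boot all_order all_algebra zify lra ring.
From mathcomp Require Import reals exp.
Set Implicit Arguments.
Unset Strict Implicit.
Unset Printing Implicit Defensive.
Import Order.TTheory GRing.Theory Num.Theory.
Local Open Scope ring_scope.

(** * Powers of two and binary expansion *)

Definition pow2 (i : nat) : bool := (i == 2 ^ trunc_log 2 i)%N.

Lemma pow2P (i : nat) : reflect (exists k, i = 2 ^ k)%N (pow2 i).
Proof.
apply: (iffP eqP) => [->|[k ->]]; first by eexists.
by rewrite trunc_expnK.
Qed.

Lemma pow2_double_leq (i j : nat) : pow2 i -> pow2 j -> (i < j -> 2 * i <= j)%N.
Proof.
move=> /pow2P[k ->] /pow2P[l ->]; rewrite ltn_exp2l // => kl.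
by rewrite -expnS leq_exp2l.
Qed.

Lemma pow2_sum_surj (k r : nat) : (r < 2 ^ k)%N ->
  exists be : nat -> bool, (\sum_(0 <= i < 2 ^ k | pow2 i) i * be i = r)%N.
Proof.
elim: k r => [|k IH] r.
  rewrite expn0 ltnS leqn0 => /eqP->; exists xpredT.
  by rewrite big_nat_cond big1 // => i; case: i.
move=> hr; have h : (0 < 2 ^ k)%N by rewrite expn_gt0.
have [be Hbe] : exists be : nat -> bool,
    (\sum_(0 <= i < 2 ^ k | pow2 i) i * be i = r - (2 ^ k <= r) * 2 ^ k)%N.
  by apply: IH; move: hr; rewrite expnS; case: leqP; lia.
(* Top binary digit first: bit [k] is set exactly when [2 ^ k <= r], and the induction hypothesis
   encodes the remainder. *)
exists (fun i => if i == (2 ^ k)%N then (2 ^ k <= r)%N else be i).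
rewrite (@big_cat_nat _ _ _ (2 ^ k)%N) //=; last by rewrite leq_exp2l.
rewrite [X in (X + _)%N](_ : _ = r - (2 ^ k <= r) * 2 ^ k)%N; last first.
  rewrite -Hbe; apply: congr_big_nat => // i /andP[_ /andP[_ hi]].
  by rewrite ltn_eqF.
rewrite big_ltn_cond; last by rewrite ltn_exp2l.
have -> : pow2 (2 ^ k) by apply/pow2P; exists k.
rewrite eqxx big_nat_cond big1 ?addn0; first by case: leqP; lia.
move=> i /andP[/andP[h1 h2] /pow2P[l]] E; move: h1 h2.
by rewrite E ltn_exp2l // ltn_exp2l //; lia.
Qed.

(** Rounding [n] up to a power of two adds no new power of two to the range. *)
Lemma pow2_sum_surj_lt (n r : nat) : (r < n)%N ->
  exists be : nat -> bool, (\sum_(1 <= i < n | pow2 i) i * be i = r)%N.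
Proof.
move=> rn.
have [n1|n1] := leqP n 1.
  by exists xpredT; rewrite big_geq //; lia.
have /andP[hlo hhi] := up_log_bounds (isT : (1 < 2)%N) n1.
have [be <-] := pow2_sum_surj (leq_trans rn hhi).
exists be; rewrite (@big_cat_nat _ _ _ n 0 (2 ^ up_log 2 n)%N) //=.
rewrite [X in _ = (_ + X)%N]big_nat_cond [X in _ = (_ + X)%N]big1 ?addn0.
  by rewrite [RHS]big_ltn_cond ?(ltn_trans _ n1) //; case: ifP.
move=> i /andP[/andP[h1 h2] /pow2P[l]] E; move: h1 h2; rewrite E => h1.
have := leq_trans hlo h1.
by rewrite !ltn_exp2l //; lia.
Qed.

(** * Order of representatives in ['Z_q] *)

Lemma val_ZpN1 (p : nat) : ((-1 : 'Z_p.+2)%R : nat) = p.+1.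
Proof. by rewrite /= /Zp_trunc /= !modn_small ?subSS ?subn0. Qed.

Lemma Zp_eq0 (p : nat) (x : 'Z_p.+2) : (x == 0) = (x == 0%N :> nat).
Proof. by []. Qed.

Lemma val_Zp_pred (p : nat) (x : 'Z_p.+2) :
  x != 0 -> ((x - 1 : 'Z_p.+2)%R : nat) = x.-1.
Proof.
rewrite Zp_eq0 => x0; have hx : (x < p.+2)%N := ltn_ord x.
rewrite -[LHS]/((x + (-1 : 'Z_p.+2)%R) %% p.+2)%N val_ZpN1.
have -> : (x + p.+1 = x.-1 + p.+2)%N by lia.
by rewrite modnDr modn_small //; lia.
Qed.

(** For [x != 0] the representatives of [x - 1] and [x] are consecutive, so only the value [x - 1]
    separates the two comparisons, and [e + x] takes it only for [e = -1]. *)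
Lemma Zp_pred_leq (p : nat) (x e : 'Z_p.+2) : x != 0 -> e != -1 ->
  ((x - 1)%R <= (e + x)%R)%N = (x <= (e + x)%R)%N.
Proof.
move=> x0 e1; rewrite val_Zp_pred //.
have h : ((e + x)%R : nat) != x.-1.
  by rewrite -val_Zp_pred // [in X in _ != X]addrC val_eqE (inj_eq (addIr x)).
by move: x0; rewrite Zp_eq0; lia.
Qed.

Lemma Zp_three_symbols (q : nat) (hq : (4 <= q)%N) (b1 b2 : bool) (c : 'Z_q) :
  exists s0 s1 s2 : 'Z_q,
    [/\ (s0 <= s1)%N = b1, (s1 <= s2)%N = b2 & s0 + s1 + s2 = c].
Proof.
case: q hq c => [|[|[|[|p]]]] // _ c.
have hc : (c < p.+4)%N := ltn_ord c.
have v2 : ((1 + 1 : 'Z_p.+4)%R : nat) = 2%N by [].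
have N1 := val_ZpN1 p.+2.
case: b1 b2 => [] [].
- by exists 0, 0, c; rewrite !add0r; split.
- exists (c + 1), (-1), 0; rewrite N1; split => //; last by rewrite addr0 addrK.
  by rewrite -ltnS; exact: ltn_ord.
- have [->|c0] := eqVneq c 0.
    by exists (-1), 0, 1; rewrite N1 addr0 addNr.
  exists c, 0, 0; rewrite !addr0; split => //.
  by move: c0; rewrite Zp_eq0; case: (nat_of_ord c).
(* A double descent: [c - 1 > 1 > 0] works unless [c] is 1 or 2. These two use [-1 > 2], which is
   where [4 <= q] matters. *)
- have [->|c1] := eqVneq c 1.
    by exists (-1), (1 + 1), 0; rewrite N1 v2 addr0 addrA addNr add0r.
  have [->|c2] := eqVneq c (1 + 1).
    by exists (-1), (1 + 1), 1; rewrite N1 v2 !addrA addNr add0r.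
  exists (c - 1), 1, 0; rewrite addr0 subrK; split => //.
  have [->|c0] := eqVneq c 0; first by rewrite sub0r N1.
  rewrite val_Zp_pred //; move: c0 c1 c2; rewrite -!val_eqE /=.
  by move: (nat_of_ord c) => [|[|[|m]]].
Qed.

(** * Completing free data to a codeword *)

Lemma pow2_4 : pow2 4. Proof. by apply/pow2P; exists 2. Qed.

(** Beyond 4, the neighbours of distinct powers of two do not collide. At 4 they do: position 3
    follows 2 and precedes 4, hence its separate treatment. *)
Lemma pow2_isolated (i : nat) : (4 < i)%N -> pow2 i ->
  ~~ pow2 i.-1 /\ ~~ pow2 i.-2.
Proof.
move=> i4 pi; split; first by apply/negP => /pow2_double_leq/(_ pi); lia.
by apply/negP => /pow2_double_leq/(_ pi); lia.
Qed.

(** The symbol just before a power of two; before 4 it is the maximal symbol. *)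
Definition anchor (q : nat) (d : nat -> 'Z_q) (i : nat) : 'Z_q :=
  if i == 3 then -1 else d i.

(* [be] holds the wanted values of alpha at the powers of two, [h] the first
   three symbols. The datum at [2 ^ j + 1] is the difference with the symbol at
   [2 ^ j - 1], so that the exclusion [s_(i+1) <> s_(i-1) - 1] becomes
   [d (i+1) <> -1] and the admissible data form a product. *)
Definition fill (q : nat) (d : nat -> 'Z_q) (be : nat -> bool) (h : nat -> 'Z_q)
    (i : nat) : 'Z_q :=
  if (i < 3)%N then h i
  else if i == 3 then -1
  else if pow2 i then anchor d i.-1 - (~~ be i)%:R
  else if pow2 i.-1 then d i + anchor d i.-2
  else d i.

Lemma fill_anchor (q : nat) (d : nat -> 'Z_q) (be : nat -> bool)
    (h : nat -> 'Z_q) (i : nat) : (2 < i)%N -> pow2 i.+1 ->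
  fill d be h i = anchor d i.
Proof.
move=> i2 pi; rewrite /fill /anchor ltnNge i2 /=; case: eqP => //= i3.
have i4 : (4 < i.+1)%N by lia.
have [/= h1 /= h2] := pow2_isolated i4 pi.
by rewrite (negbTE h1) (negbTE h2).
Qed.

Lemma fill_pow2 (q : nat) (d : nat -> 'Z_q) (be : nat -> bool)
    (h : nat -> 'Z_q) (i : nat) : (3 < i)%N -> pow2 i ->
  fill d be h i = anchor d i.-1 - (~~ be i)%:R.
Proof.
by move=> i3 pi; rewrite /fill pi; case: ifP => [|_]; [lia | case: eqP => //; lia].
Qed.

Lemma fill_after_pow2 (q : nat) (d : nat -> 'Z_q) (be : nat -> bool)
    (h : nat -> 'Z_q) (i : nat) : (4 < i)%N -> pow2 i.-1 ->
  fill d be h i = d i + anchor d i.-2.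
Proof.
move=> i4 pi; have Npi : ~~ pow2 i.
  by apply/negP => /(pow2_double_leq pi); lia.
rewrite /fill pi (negbTE Npi); case: ifP => [|_]; first by lia.
by case: eqP => //; lia.
Qed.

Lemma fill_free (q : nat) (d : nat -> 'Z_q) (be : nat -> bool)
    (h : nat -> 'Z_q) (i : nat) : (3 < i)%N -> ~~ pow2 i -> ~~ pow2 i.-1 ->
  fill d be h i = d i.
Proof.
move=> i3 p0 p1; rewrite /fill (negbTE p0) (negbTE p1).
by case: ifP => [|_]; [lia | case: eqP => //; lia].
Qed.

(** A nonzero anchor makes subtracting 1 a genuine descent instead of a wrap to [q - 1]. *)
Lemma fill_ascent_pow2 (q : nat) (hq : (1 < q)%N) (d h : nat -> 'Z_q)
    (be : nat -> bool) (i : nat) :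
  (3 < i)%N -> pow2 i -> anchor d i.-1 != 0 ->
  (fill d be h i.-1 <= fill d be h i)%N = be i.
Proof.
case: q hq d h => [|[|p]] // _ d h i3 pi a0.
rewrite (fill_pow2 _ _ _ i3 pi) fill_anchor ?prednK //; try lia.
case: (be i); first by rewrite subr0 leqnn.
rewrite val_Zp_pred //; move: a0; rewrite Zp_eq0.
by case: (nat_of_ord _) => //= m; lia.
Qed.

(* The only step out of a power of two compares [e + x] with [x] or [x - 1],
   and these comparisons agree because [e + x != x - 1]. *)
Lemma fill_ascent_other (q : nat) (hq : (1 < q)%N) (d h : nat -> 'Z_q)
    (be : nat -> bool) (i : nat) :
  (3 < i)%N -> ~~ pow2 i ->
  (pow2 i.-1 -> d i != -1 /\ anchor d i.-2 != 0) ->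
  (fill d be h i.-1 <= fill d be h i)%N =
  (fill d xpredT (fun=> 0%R) i.-1 <= fill d xpredT (fun=> 0%R) i)%N.
Proof.
case: q hq d h => [|[|p]] // _ d h i3 Npi H.
have i4 : (4 < i)%N.
  by rewrite ltn_neqAle i3 andbT; apply: contraNneq Npi => <-; exact: pow2_4.
have [pi|Npi1] := boolP (pow2 i.-1).
  have [d1 a0] := H pi.
  rewrite !(fill_after_pow2 _ _ _ i4 pi) !fill_pow2 //; try lia.
  by case: (be _); rewrite subr0 ?Zp_pred_leq.
rewrite !(fill_free _ _ _ i3 Npi Npi1).
have [pi|Npi2] := boolP (pow2 i.-2).
  have i5 : (4 < i.-1)%N.
    have : i != 5 by apply: contraNneq Npi1 => ->; exact: pow2_4.
    lia.
  by rewrite !(fill_after_pow2 _ _ _ i5 pi).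
by rewrite !fill_free //; lia.
Qed.

Lemma vt_syn_aux_seq (q n : nat) (s : nat -> 'Z_q) : (0 < n)%N ->
  vt_syn (aux_seq [tuple s i | i < n]) =
  ((\sum_(1 <= i < n) i * (s i.-1 <= s i)) %% n)%N.
Proof.
move=> n0; rewrite /vt_syn /aux_seq size_mkseq size_tuple prednK //.
congr (_ %% _)%N; apply: congr_big_nat => // i /andP[_ /andP[i1 i2]].
have i3 : (i.-1 < n)%N by lia.
rewrite nth_mkseq; last by lia.
rewrite prednK //.
rewrite -[i]/(nat_of_ord (Ordinal i2)).
by rewrite -[X in nth _ _ X]/(nat_of_ord (Ordinal i3)) !nth_mktuple.
Qed.
Lemma VT_fill (q n a : nat) (b : 'Z_q) (d : nat -> 'Z_q) :
  (4 <= q)%N -> (3 < n)%N -> (a < n)%N ->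
  (forall i, (4 < i < n)%N -> pow2 i.-1 -> d i != -1) ->
  (forall i, (3 < i)%N -> (i.+1 < n)%N -> pow2 i.+1 -> d i != 0) ->
  exists be h, [tuple fill d be h i | i < n] \in VT n a b.
Proof.
move=> hq n3 an dN1 d0.
have q1 : (1 < q)%N by lia.
have N1max (x : 'Z_q) : (x <= (-1 : 'Z_q)%R)%N.
  case: q q1 x {hq b d dN1 d0} => [|[|p]] // _ x.
  by rewrite val_ZpN1 -ltnS ltn_ord.
have anchor0 i : (2 < i)%N -> (i.+1 < n)%N -> pow2 i.+1 -> anchor d i != 0.
  move=> i2 i1 pi; rewrite /anchor.
  case: (i =P 3) => [_|i3]; last by apply: d0; lia.
  by rewrite oppr_eq0 oner_neq0.
(* The ascents outside the powers of two depend on neither [be] nor [h], so dummy values serve to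
   compute them; at 3 the maximal symbol forces an ascent. *)
pose al i : bool := (i == 3) ||
  (fill d xpredT (fun=> 0%R) i.-1 <= fill d xpredT (fun=> 0%R) i)%N.
pose K := (\sum_(1 <= i < n | ~~ pow2 i) i * al i)%N.
(* The residue [a - K] modulo [n], which the powers of two must contribute. *)
have rn : ((a + (n - K %% n)) %% n < n)%N by rewrite ltn_mod; lia.
have [be Hbe] := pow2_sum_surj_lt rn.
(* From position 3 on [fill] ignores [h], so the sum left to the first three symbols is known before
   they are chosen. *)
have [s0 [s1 [s2 [H1 H2 Hs]]]] := Zp_three_symbols hq (be 1%N) (be 2%N)
  (b - \sum_(3 <= i < n) fill d be (fun=> 0%R) i).
pose h i := nth 0 [:: s0; s1; s2] i.
exists be, h; rewrite inE; apply/andP; split; apply/eqP; last first.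
  under eq_bigr do rewrite tnth_mktuple.
  rewrite -(big_mkord xpredT (fill d be h)).
  rewrite (@big_cat_nat _ _ _ 3) //=; last by lia.
  rewrite big_ltn // big_ltn // big_ltn // big_geq // addr0.
  rewrite {1 2 3}/fill /= addrA Hs.
  rewrite -[RHS](subrK (\sum_(3 <= i < n) fill d be (fun=> 0%R) i)).
  congr (_ + _); apply: eq_big_nat => i /andP[i3 _].
  by rewrite /fill ltnNge i3.
rewrite vt_syn_aux_seq; last by lia.
have -> : (\sum_(1 <= i < n) i * (fill d be h i.-1 <= fill d be h i) =
    (a + (n - K %% n)) %% n + K)%N.
  rewrite (bigID pow2) /= -Hbe; congr (_ + _)%N; apply: congr_big_nat => // i.
    case/andP => pi /andP[i1 i2]; congr (_ * nat_of_bool _)%N.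
    have [i3|i3] := ltnP 3 i.
      rewrite fill_ascent_pow2 //; apply: anchor0; rewrite ?prednK //; lia.
    have [->|->] : i = 1%N \/ i = 2%N.
      have i4 : i != 3 by apply: contraTneq pi => ->.
      lia.
    - by rewrite /fill.
    - by rewrite /fill.
  case/andP => pi /andP[i1 i2]; congr (_ * nat_of_bool _)%N.
  rewrite /al; have [->|i3] := eqVneq i 3; first by rewrite {2}/fill N1max.
  have i4 : (3 < i)%N.
    have j1 : i != 1%N by apply: contraNneq pi => ->; apply/pow2P; exists 0%N.
    have j2 : i != 2%N by apply: contraNneq pi => ->; apply/pow2P; exists 1%N.
    by lia.
  have i5 : i != 4 by apply: contraNneq pi => ->; exact: pow2_4.
  rewrite /= -(@fill_ascent_other _ q1 d h be) // => pi1; split.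
    by apply: dN1 => //; lia.
  by apply: anchor0; rewrite ?prednK //; lia.
rewrite modnDml -modnDmr -addnA subnK; first by rewrite modnDr modn_small.
by rewrite ltnW // ltn_mod; lia.
Qed.

(** * Counting codewords through their free data *)

Definition forced (i : nat) : bool := (i < 4)%N || pow2 i.

(** Forced positions carry the dummy datum 0. The guard [i.+1 < n] lifts the exclusion of 0 when the
    next power of two falls outside the word. *)
Definition free_symbols (q n i : nat) : {set 'Z_q} :=
  if forced i then [set 0]
  else if pow2 i.-1 then [set~ -1]
  else if pow2 i.+1 && (i.+1 < n)%N then [set~ 0]
  else setT.

Definition free_data (q n : nat) (S : n.-tuple 'Z_q) : {ffun 'I_n -> 'Z_q} :=
  [ffun i : 'I_n => if forced i then 0 else
     nth 0 S i - (if pow2 i.-1 then nth 0 S i.-2 else 0)].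

(** [free_data] undoes [fill] and reads only symbols unaffected by [be] and [h]. Being onto the
    admissible data, it bounds the size of the code from below. *)
Lemma free_data_VT_surj (q n a : nat) (b : 'Z_q) (f : {ffun 'I_n -> 'Z_q}) :
  (4 <= q)%N -> (3 < n)%N -> (a < n)%N ->
  f \in family (fun i : 'I_n => free_symbols q n i) ->
  f \in @free_data q n @: VT n a b.
Proof.
move=> hq n3 an /familyP fA.
pose d i := oapp f 0 (insub i : option 'I_n).
have dE (i : 'I_n) : d i = f i by rewrite /d valK.
have [||be [h S_VT]] := @VT_fill q n a b d hq n3 an.
- move=> i /andP[i4 i_n] pi; rewrite -[i]/(nat_of_ord (Ordinal i_n)) dE.
  have Npi : ~~ pow2 i by apply/negP => /(pow2_double_leq pi); lia.
  have := fA (Ordinal i_n); rewrite /free_symbols /= /forced (negbTE Npi) pi.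
  by rewrite ltnNge (ltnW i4) !inE.
- move=> i i3 i1n pi; have i_n := ltnW i1n.
  have i4 : (4 < i.+1)%N by [].
  have [/= p0 p1] := pow2_isolated i4 pi.
  rewrite -[i]/(nat_of_ord (Ordinal i_n)) dE.
  have := fA (Ordinal i_n); rewrite /free_symbols /= /forced.
  by rewrite (negbTE p0) (negbTE p1) pi i1n ltnNge i3 !inE.
apply/imsetP; exists [tuple fill d be h i | i < n] => //.
have nthE j : (j < n)%N -> nth 0 [tuple fill d be h i | i < n] j = fill d be h j.
  by move=> jn; rewrite -[j]/(nat_of_ord (Ordinal jn)) nth_mktuple.
apply/ffunP => i; rewrite ffunE; have := fA i; rewrite /free_symbols.
case: ifPn => [_|]; first by rewrite inE => /eqP.
rewrite /forced negb_or -leqNgt => /andP[i3 pi] _.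
have i4 : i != 4 :> nat by apply: contraNneq pi => ->; exact: pow2_4.
have i2n : (i.-2 < n)%N by have := ltn_ord i; lia.
rewrite !nthE //; case: ifPn => p1; last by rewrite subr0 fill_free.
have i5 : (4 < i)%N by lia.
rewrite (fill_after_pow2 _ _ _ i5 p1) fill_anchor ?addrK ?dE //; first by lia.
by rewrite (_ : i.-2.+1 = i.-1) //; lia.
Qed.

Lemma leq_prod_card_VT (q n a : nat) (b : 'Z_q) :
  (4 <= q)%N -> (3 < n)%N -> (a < n)%N ->
  (\prod_(0 <= i < n) #|free_symbols q n i| <= #|VT n a b|)%N.
Proof.
move=> hq n3 an; apply: leq_trans (leq_imset_card (@free_data q n) (VT n a b)).
have -> : (\prod_(0 <= i < n) #|free_symbols q n i| =
    #|family (fun i : 'I_n => free_symbols q n i)|)%N.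
  by rewrite card_family foldrE big_image /= big_mkord.
by apply/subset_leq_card/subsetP => f; exact: free_data_VT_surj.
Qed.

Lemma card_free_symbols (q n i : nat) : (1 < q)%N ->
  #|free_symbols q n i| =
  if forced i then 1%N
  else if pow2 i.-1 || pow2 i.+1 && (i.+1 < n)%N then q.-1 else q.
Proof.
case: q => [|[|p]] // _; rewrite /free_symbols.
case: ifP => _; first by rewrite cards1.
case: ifP => _ /=; first by rewrite cardsC1 card_ord.
by case: ifP => _; rewrite ?cardsC1 ?cardsT card_ord.
Qed.

(** * Evaluating the product block by block *)

Lemma pow2_between (k i : nat) : (2 ^ k < i < 2 ^ k.+1)%N -> ~~ pow2 i.
Proof.
case/andP => h1 h2; apply/pow2P => -[l E]; move: h1 h2.
by rewrite E !ltn_exp2l //; lia.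
Qed.

Lemma pow2_exp (k : nat) : pow2 (2 ^ k). Proof. by apply/pow2P; exists k. Qed.

(** Only the position right after [2 ^ k] loses a symbol: the block either stops short of
    [2 ^ k.+1 - 1], or ends the word, where the guard applies. *)
Lemma prod_card_block (q n k r : nat) : (1 < q)%N -> (1 < k)%N ->
  (2 ^ k + 2 <= r <= n)%N -> (r < 2 ^ k.+1 \/ r = n /\ n <= 2 ^ k.+1)%N ->
  (\prod_((2 ^ k).+1 <= i < r) #|free_symbols q n i| =
   q.-1 * q ^ (r - (2 ^ k).+2))%N.
Proof.
move=> q1 k1 /andP[hr rn] hb.
have k4 : (4 <= 2 ^ k)%N by exact: (@leq_pexp2l 2 2 k).
have k2 : (2 ^ k.+1 = 2 ^ k + 2 ^ k)%N by rewrite expnS; lia.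
rewrite big_ltn; last by lia.
rewrite card_free_symbols // pow2_exp /= /forced.
rewrite (negbTE (pow2_between (k := k) _)); last by lia.
rewrite ltnNge (leq_trans k4) //=; congr (_ * _)%N.
rewrite -prod_nat_const_nat; apply: eq_big_nat => i /andP[i1 i2].
rewrite card_free_symbols // /forced.
rewrite (negbTE (pow2_between (k := k) (i := i) _)); last by lia.
rewrite (negbTE (pow2_between (k := k) (i := i.-1) _)); last by lia.
rewrite (_ : (i < 4)%N = false) /=; last by lia.
have [hi|hi] := ltnP i.+1 n; last by rewrite andbF.
by rewrite (negbTE (pow2_between (k := k) (i := i.+1) _)) //; lia.
Qed.
(** Positions 0 to 4 are forced; each later block up to [2 ^ k.+1] loses a symbol at both ends and
    contributes [q.-1 ^ 2 * q ^ (2 ^ k - 3)]. The first conjunct keeps the truncated subtraction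
    exact. *)
Lemma prod_card_free_symbols_pow2 (q n m : nat) : (1 < q)%N ->
  (2 ^ m.+2 < n)%N ->
  (3 * m + 4 <= 2 ^ m.+2)%N /\
  (\prod_(0 <= i < (2 ^ m.+2).+1) #|free_symbols q n i| =
   q.-1 ^ (2 * m) * q ^ (2 ^ m.+2 - (3 * m + 4)))%N.
Proof.
move=> q1; elim: m => [|m IH] hn.
  split=> //; rewrite big_nat_cond big1 ?muln1 // => i /andP[/andP[_ i5] _].
  rewrite card_free_symbols // /forced; case: ltnP => //= i4.
  by have -> : i = 4 by apply/eqP; rewrite eqn_leq i4 andbT -ltnS; exact: i5.
have e2 : (2 ^ m.+3 = 2 ^ m.+2 + 2 ^ m.+2)%N by rewrite expnS; lia.
have [|le IHm] := IH; first by lia.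
have k4 : (4 <= 2 ^ m.+2)%N by exact: (@leq_pexp2l 2 2 m.+2).
split; first by lia.
have [N eN] : exists N, (2 ^ m.+3 = N.+1)%N by exists (2 ^ m.+3).-1; lia.
(* Split off the power of two [N.+1], which is forced, and its predecessor [N], which excludes 0. *)
rewrite eN !big_nat_recr //=.
rewrite (card_free_symbols n N.+1 q1) /forced -eN pow2_exp orbT.
rewrite (card_free_symbols n N q1) -eN pow2_exp hn orbT /forced.
rewrite (negbTE (pow2_between (k := m.+2) _)); last by lia.
rewrite (_ : (N < 4)%N = false) /=; last by lia.
rewrite (@big_cat_nat _ _ _ (2 ^ m.+2).+1) //=; last by lia.
rewrite IHm prod_card_block //; try lia.
rewrite muln1 mulnACA -expnSr -expnD mulnAC -expnSr.
by congr (_ ^ _ * _ ^ _)%N; lia.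
Qed.

(** With [t = m + 3] the exponents are [2t - 5] and [n - 3t + 3]; the last, partial block supplies
    the odd factor [q.-1]. *)
Lemma leq_prod_card_free_symbols (q n m : nat) : (1 < q)%N -> (5 < n)%N ->
  (2 ^ m.+2 < n <= 2 ^ m.+3)%N ->
  (3 * m + 6 <= n)%N /\
  (q.-1 ^ (2 * m + 1) * q ^ (n - (3 * m + 6)) <=
   \prod_(0 <= i < n) #|free_symbols q n i|)%N.
Proof.
move=> q1 n5 /andP[h1 h2].
have [le E] := prod_card_free_symbols_pow2 q1 h1.
have le' : (3 * m + 6 <= n)%N.
  case: m h1 {h2 le E} => [|m]; first by lia.
  by have := @ltn_expl 2 m isT; rewrite !expnS; lia.
split=> //; rewrite (@big_cat_nat _ _ _ (2 ^ m.+2).+1) //= E.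
have [hn|hn] := ltnP (2 ^ m.+2).+1 n.
  rewrite prod_card_block //; [|lia|by right].
  rewrite mulnACA -expnSr -expnD; apply/eq_leq.
  by congr (_ ^ _ * _ ^ _)%N; lia.
(* Here [n = 2 ^ m.+2 + 1] and the last block is empty: one factor [q] is weakened to [q.-1]. *)
rewrite [X in (_ <= _ * X)%N]big_geq // muln1 addn1 expnSr -mulnA.
rewrite (_ : 2 ^ m.+2 - (3 * m + 4) = (n - (3 * m + 6)).+1)%N; last by lia.
by rewrite leq_mul2l expnS leq_mul2r leq_pred !orbT.
Qed.

(** * The exponential form and the logarithm *)

Lemma powR_log_exponent (R : realType) (q' n' t' : R) (u v : int) :
  1 < q' - 1 -> n' != 0 -> u%:~R = 2 * t' - 5 -> v%:~R = n' - 3 * t' + 3 ->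
  (q' - 1) ^ u * q' ^ v =
  q' `^ (n' * (1 - t' / n' * (3 * logb q' q' - 2 * logb q' (q' - 1))
                 - 1 / n' * (5 * logb q' (q' - 1) - 3 * logb q' q'))).
Proof.
move=> q1 n0 hu hv.
have q0 : 0 < q' by lra.
have lq : ln q' != 0 by rewrite ln_eq0; lra.
have e : q' - 1 = q' `^ logb q' (q' - 1).
  by rewrite /powR gt_eqF // /logb divfK // lnK // posrE; lra.
have -> : n' * (1 - t' / n' * (3 * logb q' q' - 2 * logb q' (q' - 1))
                 - 1 / n' * (5 * logb q' (q' - 1) - 3 * logb q' q')) =
    logb q' (q' - 1) * u%:~R + v%:~R.
  rewrite hu hv (_ : logb q' q' = 1) /logb ?divff //.
  (* Once the logarithm of [q' - 1] is opaque, a rational identity remains. *)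
  by move: (_ / ln q') => L; field.
rewrite powRD; last by apply/implyP => _; rewrite gt_eqF.
by rewrite powRrM -e !powR_intmul //; apply/ltW => //; lra.
Qed.

Lemma ceil_log2 (R : realType) (n k : nat) : (2 ^ k < n <= 2 ^ k.+1)%N ->
  Num.ceil (logb 2 (n%:R : R)) = k.+1%:Z.
Proof.
case/andP => h1 h2.
have l2 : 0 < ln (2 : R) by rewrite ln_gt0 // ltr1n.
have n0 : (0 < n)%N by apply: leq_ltn_trans h1.
have lnX j : ln ((2 ^ j)%:R : R) = j%:R * ln 2.
  by rewrite natrX lnXn ?ltr0n // mulr_natl.
apply: ceil_def; rewrite /logb ltr_pdivlMr // ler_pdivrMr //.
rewrite (_ : k.+1%:Z - 1 = k%:Z); last by lia.
rewrite -!pmulrn -!lnX ltr_ln ?posrE ?ltr0n ?expn_gt0 //.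
by rewrite ler_ln ?posrE ?ltr0n ?expn_gt0 // ltr_nat ler_nat h1.
Qed.

Theorem proposition1 (R : realType) (n q : nat)
    (hn : (6 <= n)%N) (hq : (4 <= q)%N)
    (a : nat) (ha : (a <= n - 1)%N) (b : 'Z_q) :
  let t : int := Num.ceil (logb 2 (n%:R : R)) in
  let n' : R := n%:R in
  let q' : R := q%:R in
  let t' : R := t%:~R in
  let bound : R := (q' - 1) ^ (2 * t - 5) * q' ^ (n%:Z - 3 * t + 3) in
  (#|VT n a b|%:R >= bound) /\
  bound = q' `^ (n' * (1
                       - t' / n' * (3 * logb q' q' - 2 * logb q' (q' - 1))
                       - 1 / n' * (5 * logb q' (q' - 1) - 3 * logb q' q'))).
Proof.
move=> t n' q' t' bound; split; last first.
  apply: powR_log_exponent.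
  - by have : 4 <= q' by [rewrite (ler_nat R 4)]; lra.
  - by rewrite pnatr_eq0; lia.
  - by rewrite rmorphB rmorphM.
  - by rewrite rmorphD rmorphB rmorphM.
(* Since [n] exceeds 4, the rounded-up logarithm is at least 3 and can be written [m + 3]. *)
have [m hm] : exists m, (2 ^ m.+2 < n <= 2 ^ m.+3)%N.
  have n1 : (1 < n)%N by lia.
  have /andP[h1 h2] := up_log_bounds (isT : (1 < 2)%N) n1.
  move: h1 h2; case: (up_log 2 n) => [|[|[|m]]] h1 h2.
  4: by exists m; rewrite h1.
  - by move: h2; rewrite expn0; lia.
  - by move: h2; rewrite expn1; lia.
  - by have /= := leq_trans hn h2.
have q1 : (1 < q)%N by lia.
have [le H] := leq_prod_card_free_symbols q1 hn hm.
have n3 : (3 < n)%N by lia.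
have an : (a < n)%N by lia.
have {}H := leq_trans H (leq_prod_card_VT b hq n3 an).
have -> : bound = (q.-1 ^ (2 * m + 1) * q ^ (n - (3 * m + 6)))%:R.
  rewrite /bound /t (ceil_log2 _ hm) natrM !natrX -subn1 natrB; last by lia.
  rewrite (_ : 2 * m.+3%:Z - 5 = (2 * m + 1)%N); last by lia.
  by rewrite (_ : n%:Z - 3 * m.+3%:Z + 3 = (n - (3 * m + 6))%N) //; lia.
by rewrite ler_nat.
Qed.
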